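(* Let $\Theta_{<\omega^2}=\mathcal U_{<\omega^2}\circ\Gamma:\operatorname{Idl}(\mathcal D_T)\to\operatorname{Idl}(\mathcal D_T)$. The closure ordinal of $\Theta_{<\omega^2}$ from $\downarrow\mathbf 0$ is exactly $\omega^2$, and its least fixed point is $$A_{\omega^2}=\bigcup_{\beta<\omega^2}\downarrow\mathbf 0^{(\beta)}.$$
   Context: Let $\mathcal D_T$ be the poset of Turing degrees under Turing reducibility $\leq_T$, with least degree $\mathbf 0$, join $\mathbf a\vee\mathbf b=\deg_T(A\oplus B)$ and Turing jump $\mathbf a\mapsto\mathbf a'$. A Turing ideal is a nonempty subset $I\subseteq\mathcal D_T$ that is closed downward under $\leq_T$ and closed under $\vee$; $\operatorname{Idl}(\mathcal D_T)$ is the set of Turing ideals ordered by inclusion. For a degree $\mathbf a$, $\downarrow\mathbf a=\{\mathbf b:\mathbf b\leq_T\mathbf a\}$; for a set $S$ of degrees, $\downarrow S=\{\mathbf b:\exists\mathbf s\in S\ (\mathbf b\leq_T\mathbf s)\}$; and $\langle S\rangle$ is the smallest Turing ideal containing $S$ (for $S$ nonempty). Iterated jumps below $\omega^2$ (every ordinal below $\omega^2$ is uniquely $\omega k+n$ with $k,n<\omega$): as sets, $0^{(0)}=\emptyset$; $0^{(\alpha+1)}=(0^{(\alpha)})'$; and for $k\geq1$, $0^{(\omega k)}=\bigoplus_{n<\omega}0^{(\omega(k-1)+n)}=\{\langle n,x\rangle:x\in 0^{(\omega(k-1)+n)}\}$. Write $\mathbf 0^{(\alpha)}=\deg_T(0^{(\alpha)})$.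 For $k\geq1$ put $A_{\omega k}=\bigcup_{\beta<\omega k}\downarrow\mathbf 0^{(\beta)}$. Operators on $\operatorname{Idl}(\mathcal D_T)$: $$\Gamma(I)=\downarrow\{\mathbf a':\mathbf a\in I\},\qquad \mathcal U_{<\omega^2}(I)=\left\langle I\cup\{\mathbf 0^{(\omega k)}:1\leq k<\omega\text{ and }A_{\omega k}\subseteq I\}\right\rangle.$$ Iteration of an operator $\Theta$ from $I_0=\downarrow\mathbf 0$: $I_{\alpha+1}=\Theta(I_\alpha)$, and $I_\lambda=\bigcup_{\alpha<\lambda}I_\alpha$ for limit ordinals $\lambda$. The closure ordinal of $\Theta$ from $\downarrow\mathbf 0$ is the least ordinal $\alpha$ with $\Theta(I_\alpha)=I_\alpha$. The least fixed point is the least, under inclusion, Turing ideal $I$ with $\Theta(I)=I$. *)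

(* Defs.v *)
From HB Require Import structures.
From Stdlib Require Cantor.
From mathcomp Require Import all_boot all_order.
From mathcomp Require Import boolp classical_sets.

Set Implicit Arguments.
Unset Strict Implicit.
Unset Printing Implicit Defensive.

Import Order.Theory Order.LexiSyntax.

Local Open Scope classical_set_scope.
Local Open Scope quotient_scope.

Definition pairN (x y : nat) : nat := Cantor.to_nat (x, y).
Definition fstN (z : nat) : nat := (Cantor.of_nat z).1.
Definition sndN (z : nat) : nat := (Cantor.of_nat z).2.

(** Oracle programs: Kleene's mu-recursive functions relative to an oracle, in
    their unary form (several arguments are passed as one Cantor-coded tuple). *)
Inductive prog : Type :=
| Zero | Succ | Fst | Snd | Oracle
| Pair of prog & prog
| Comp of prog & prog
| Prec of prog & prog
| Mu of prog.

(** [primrec f g a n y] holds iff the partial function defined by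
    h(a,0) = f(a), h(a,n+1) = g(a,(n,h(a,n))) is defined at (a,n), with value y. *)
Fixpoint primrec (f g : nat -> nat -> Prop) (a n y : nat) : Prop :=
  if n is m.+1 then
    exists2 z, primrec f g a m z & g (pairN a (pairN m z)) y
  else f a y.

(** [ev A p] is the graph of the partial function that [p] computes with oracle
    [A]: [ev A p x y] means that [p] halts on input [x] with output [y]. *)
Fixpoint ev (A : set nat) (p : prog) : nat -> nat -> Prop :=
  match p with
  | Zero => fun x y => y = 0
  | Succ => fun x y => y = x.+1
  | Fst => fun x y => y = fstN x
  | Snd => fun x y => y = sndN x
  | Oracle => fun x y => y = (x \in A)
  | Pair f g => fun x y => ev A f x (fstN y) /\ ev A g x (sndN y)
  | Comp f g => fun x y => exists2 z, ev A g x z & ev A f z y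
  | Prec f g => fun x y => primrec (ev A f) (ev A g) (fstN x) (sndN x) y
  | Mu f => fun x y => ev A f (pairN x y) 0 /\
      (forall m, m < y -> exists v, ev A f (pairN x m) v.+1)
  end.

Fixpoint encode (p : prog) : nat :=
  match p with
  | Zero => pairN 0 0
  | Succ => pairN 1 0
  | Fst => pairN 2 0
  | Snd => pairN 3 0
  | Oracle => pairN 4 0
  | Pair f g => pairN 5 (pairN (encode f) (encode g))
  | Comp f g => pairN 6 (pairN (encode f) (encode g))
  | Prec f g => pairN 7 (pairN (encode f) (encode g))
  | Mu f => pairN 8 (encode f)
  end.

Definition turing_le (A B : set nat) : Prop :=
  exists p, forall x, ev B p x (x \in A).

(** Numbers that are not of the form [encode p] do not belong to any jump. *)
Definition jump (A : set nat) : set nat :=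
  [set e | exists2 p, encode p = e & exists y, ev A p e y].

Definition oplus (A B : set nat) : set nat :=
  [set x.*2 | x in A] `|` [set x.*2.+1 | x in B].

Fixpoint subst_oracle (q p : prog) : prog :=
  match p with
  | Oracle => q
  | Pair f g => Pair (subst_oracle q f) (subst_oracle q g)
  | Comp f g => Comp (subst_oracle q f) (subst_oracle q g)
  | Prec f g => Prec (subst_oracle q f) (subst_oracle q g)
  | Mu f => Mu (subst_oracle q f)
  | p => p
  end.

Lemma ev_subst (A B : set nat) q p : (forall x, ev A q x (x \in B)) ->
  forall x y, ev B p x y -> ev A (subst_oracle q p) x y.
Proof.
move=> qB; elim: p => //=.
- by move=> x y ->; exact: qB.
- by move=> f IHf g IHg x y [/IHf ? /IHg].
- by move=> f IHf g IHg x y [z /IHg ? /IHf]; exists z.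
- move=> f IHf g IHg x y; elim: (sndN x) y => [|n IHn] y /=; first exact: IHf.
  by move=> [z /IHn ? /IHg]; exists z.
- move=> f IHf x y [/IHf ? f_gt0]; split=> // m /f_gt0[v /IHf]; by exists v.
Qed.

Lemma turing_le_refl A : turing_le A A.
Proof. by exists Oracle. Qed.

Lemma turing_le_trans A B C :
  turing_le A B -> turing_le B C -> turing_le A C.
Proof.
move=> [p pA] [q qB]; exists (subst_oracle q p) => x.
exact: ev_subst qB _ _ (pA x).
Qed.

Definition turing_eq : rel (set nat) :=
  fun A B => `[< turing_le A B /\ turing_le B A >].

Lemma turing_eq_refl : reflexive turing_eq.
Proof. by move=> A; apply/asboolP; split; exact: turing_le_refl. Qed.

Lemma turing_eq_sym : symmetric turing_eq.
Proof. by move=> A B; apply/asboolP/asboolP => -[]. Qed.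

Lemma turing_eq_trans : transitive turing_eq.
Proof.
move=> B A C /asboolP[AB BA] /asboolP[BC CB]; apply/asboolP.
by split; [exact: turing_le_trans AB BC|exact: turing_le_trans CB BA].
Qed.

Canonical turing_equiv :=
  EquivRel turing_eq turing_eq_refl turing_eq_sym turing_eq_trans.

Definition degree := {eq_quot turing_eq}.

HB.instance Definition _ := Choice.on degree.
HB.instance Definition _ := EqQuotient.on degree.

Definition deg (A : set nat) : degree := \pi_degree A.

Lemma deg_eqP (A B : set nat) :
  deg A = deg B <-> turing_le A B /\ turing_le B A.
Proof.
split=> [/eqmodP/asboolP//|AB]; by apply/eqmodP/asboolP.
Qed.

Lemma repr_degP A : turing_le (repr (deg A)) A /\ turing_le A (repr (deg A)).
Proof. by apply/deg_eqP; rewrite /deg reprK. Qed.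

Definition degree_le : rel degree := fun a b => `[< turing_le (repr a) (repr b) >].

Lemma degree_le_refl : reflexive degree_le.
Proof. by move=> a; apply/asboolP; exact: turing_le_refl. Qed.

Lemma degree_le_anti : antisymmetric degree_le.
Proof.
move=> a b /andP[/asboolP ab /asboolP ba].
by rewrite -[a]reprK -[b]reprK; apply/deg_eqP.
Qed.

Lemma degree_le_trans : transitive degree_le.
Proof.
by move=> b a c /asboolP ab /asboolP bc; apply/asboolP/(turing_le_trans ab bc).
Qed.

Fact turing_display : Order.disp_t. Proof. exact: Order.Disp tt tt. Qed.

HB.instance Definition _ := Order.Le_isPOrder.Build turing_display degree
  degree_le_refl degree_le_anti degree_le_trans.

Lemma deg_leP (A B : set nat) : (deg A <= deg B)%O <-> turing_le A B.
Proof.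
have [A1 A2] := repr_degP A; have [B1 B2] := repr_degP B.
split=> [/asboolP AB|AB].
  exact: turing_le_trans (turing_le_trans A2 AB) B1.
by apply/asboolP; exact: turing_le_trans (turing_le_trans A1 AB) B2.
Qed.

Definition deg0 : degree := deg set0.

(** [djoin] and [djump] are computed on the representative [repr]; since oplus
    and jump respect Turing equivalence, this choice does not matter. *)
Definition djoin (a b : degree) : degree := deg (oplus (repr a) (repr b)).
Definition djump (a : degree) : degree := deg (jump (repr a)).

Definition turing_ideal (I : set degree) : Prop :=
  [/\ I !=set0,
      (forall a b : degree, I b -> (a <= b)%O -> I a) &
      (forall a b : degree, I a -> I b -> I (djoin a b))].

Definition down_deg (a : degree) : set degree := [set b | (b <= a)%O].
Definition down_set (S : set degree) : set degree :=
  [set b : degree | exists2 s, S s & (b <= s)%O].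
Definition ideal_gen (S : set degree) : set degree := smallest turing_ideal S.

(** [limit_jump k] is 0^(omega k). *)
Fixpoint limit_jump (k : nat) : set nat :=
  if k is j.+1 then
    [set z | exists n x, z = pairN n x /\ iter n jump (limit_jump j) x]
  else set0.

(** The ordinal omega k + n, below omega^2, is the pair (k, n) in the
    lexicographic order; [zero_jump (k, n)] is 0^(omega k + n). *)
Definition zero_jump (b : nat *l nat) : set nat := iter b.2 jump (limit_jump b.1).

Definition A_omega (k : nat) : set degree :=
  \bigcup_(b in [set b : nat *l nat | (b < (k, 0%N))%O]) down_deg (deg (zero_jump b)).

Definition A_omega2 : set degree :=
  \bigcup_(b : nat *l nat) down_deg (deg (zero_jump b)).

Definition Gamma (I : set degree) : set degree := down_set [set djump a | a in I].

Definition U_omega2 (I : set degree) : set degree :=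
  ideal_gen (I `|` [set deg (zero_jump (k, 0%N)) | k in
                      [set k : nat | 1 <= k /\ A_omega k `<=` I]]).

Definition Theta (I : set degree) : set degree := U_omega2 (Gamma I).

Section TransfiniteIteration.
Context {d : Order.disp_t} {T : orderType d}.
Context (wfT : well_founded (fun a b : T => (a < b)%O)).

Definition is_zero_ord (a : T) : Prop := forall b : T, (a <= b)%O.
Definition is_succ_ord (a b : T) : Prop :=
  (a < b)%O /\ (forall c, (a < c)%O -> (b <= c)%O).
Definition is_limit_ord (a : T) : Prop := ~ is_zero_ord a /\ ~ exists b, is_succ_ord b a.

Context (D : Type) (Th : set D -> set D) (I0 : set D).

(** The transfinite iteration of [Th] from [I0], indexed by the well-order [T];
    it is characterized by [iteration_zero], [iteration_succ] and
    [iteration_limit] below. *)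
Definition iteration_step (a : T)
    (rec : forall b : T, (b < a)%O -> set D) : set D :=
  match pselect (exists b, is_succ_ord b a) with
  | left h => Th (rec (projT1 (cid h)) (proj1 (projT2 (cid h))))
  | right _ => if `[< is_zero_ord a >] then I0
               else [set x | exists (b : T) (ba : (b < a)%O), rec b ba x]
  end.

Definition iteration : T -> set D := Fix wfT (fun _ => set D) iteration_step.

Lemma iterationE a : iteration a = iteration_step (fun b (_ : (b < a)%O) => iteration b).
Proof.
rewrite /iteration Fix_eq// => {}a f g fg; congr iteration_step.
by apply/functional_extensionality_dep => b; apply/functional_extensionality_dep.
Qed.

Lemma iteration_zero a : is_zero_ord a -> iteration a = I0.
Proof.
move=> a0; rewrite iterationE /iteration_step; case: pselect => [h|_].
  by have [b [ba _]] := h; have := a0 b; rewrite leNgt ba.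
by rewrite asboolT.
Qed.

Lemma iteration_succ a b : is_succ_ord a b -> iteration b = Th (iteration a).
Proof.
move=> sab; rewrite iterationE /iteration_step.
case: pselect => [h|[]]; last by exists a.
case: (cid h) => c [cb cmin] /=; congr (Th (iteration _)).
case: sab => ab amin; apply/eqP; rewrite eq_le !leNgt; apply/andP; split.
  by apply/negP => /amin; rewrite leNgt cb.
by apply/negP => /cmin; rewrite leNgt ab.
Qed.

Lemma iteration_limit a : is_limit_ord a ->
  iteration a = \bigcup_(b in [set b | (b < a)%O]) iteration b.
Proof.
move=> [a0 anS]; rewrite [LHS]iterationE /iteration_step.
case: pselect => [/anS//|_]; rewrite asboolF//.
by apply/seteqP; split=> x /= [b]; [case=> ba xb; exists b|exists b].
Qed.

Definition is_closure_ordinal (a : T) : Prop :=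
  Th (iteration a) = iteration a /\
  (forall b, Th (iteration b) = iteration b -> (a <= b)%O).

End TransfiniteIteration.

(** The ordinals below omega^3: (i, (k, n)) is omega^2 i + omega k + n. *)
Definition ord3 := (nat *l (nat *l nat))%type.

Definition omega2 : ord3 := (1, (0, 0)).

Lemma lexi_wf (d1 d2 : Order.disp_t) (T1 : orderType d1) (T2 : orderType d2) :
  well_founded (fun a b : T1 => (a < b)%O) ->
  well_founded (fun a b : T2 => (a < b)%O) ->
  well_founded (fun a b : T1 *l T2 => (a < b)%O).
Proof.
move=> wf1 wf2 [x y]; elim/(well_founded_induction wf1): x y => x IHx y.
elim/(well_founded_induction wf2): y => y IHy.
constructor=> -[x' y']; rewrite ltxi_pair => /andP[].
by rewrite le_eqVlt => /predU1P[-> /implyP/(_ (lexx _))/IHy|/IHx].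
Qed.

Lemma ltn_wf : well_founded (fun a b : nat => (a < b)%O).
Proof.
by move=> n; elim/ltn_ind: n => n IHn; apply: Acc_intro => k; exact: IHn.
Qed.

Lemma ord3_wf : well_founded (fun a b : ord3 => (a < b)%O).
Proof. exact: lexi_wf ltn_wf (lexi_wf ltn_wf ltn_wf). Qed.

Definition is_least_fixpoint (Th : set degree -> set degree) (I : set degree) : Prop :=
  [/\ turing_ideal I, Th I = I &
      forall J, turing_ideal J -> Th J = J -> I `<=` J].

(* Main.v *)
Require Import Defs.
From Stdlib Require Cantor.
From mathcomp Require Import all_boot all_order.
From mathcomp Require Import boolp classical_sets.
From mathcomp Require Import zify.

Set Implicit Arguments.
Unset Strict Implicit.
Unset Printing Implicit Defensive.

Import Order.Theory Order.LexiSyntax.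

Local Open Scope classical_set_scope.

(** Every [Theta]-fixed ideal contains 0, is closed under the jump, and contains
    0^(omega k) as soon as it contains all earlier iterated jumps; hence it
    contains [A_omega2], which is itself fixed. Along the iteration, monotonicity
    of [Theta] gives I_(omega k + n) below 0^(omega k + n): at such a stage the
    only limit jumps that can be added are the 0^(omega j) with j <= k, because no
    set computes its own jump. So no stage before omega^2 contains [A_omega2],
    whereas 0^(omega k + n) enters at stage omega k + n + 1.

    That the jump respects Turing reducibility is shown by rewriting codes: the
    map [encode p |-> encode (subst_oracle q p)] is computed by course-of-values
    recursion, so no universal program is needed. *)

(** * Relative computability *)

Lemma fstK x y : fstN (pairN x y) = x.
Proof. by rewrite /fstN /pairN Cantor.cancel_of_to. Qed.

Lemma sndK x y : sndN (pairN x y) = y.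
Proof. by rewrite /sndN /pairN Cantor.cancel_of_to. Qed.

Lemma pairK z : pairN (fstN z) (sndN z) = z.
Proof. by rewrite /fstN /sndN /pairN -surjective_pairing Cantor.cancel_to_of. Qed.

Lemma pairN_ge x y : x + y <= pairN x y.
Proof. by have := Cantor.to_nat_non_decreasing x y; rewrite /pairN; lia. Qed.

#[local] Opaque pairN fstN sndN.

Lemma pairN_inj x y x' y' : pairN x y = pairN x' y' -> x = x' /\ y = y'.
Proof.
by move=> e; have := congr1 fstN e; have := congr1 sndN e; rewrite !fstK !sndK.
Qed.

(** Codes with subprograms carry a positive tag, so this strict bound makes recursion and induction
    on codes descend. *)
Lemma pairN_gt x y : 0 < x -> y < pairN x y.
Proof. by have := pairN_ge x y; lia. Qed.

Lemma fstN_le z : fstN z <= z.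
Proof. by have := pairN_ge (fstN z) (sndN z); rewrite pairK; lia. Qed.

Lemma sndN_le z : sndN z <= z.
Proof. by have := pairN_ge (fstN z) (sndN z); rewrite pairK; lia. Qed.

Lemma encode_inj : injective encode.
Proof.
elim=> [|||||f IHf g IHg|f IHf g IHg|f IHf g IHg|f IHf];
  case=> [|||||f' g'|f' g'|f' g'|f'] /= /pairN_inj[] // _.
- by move=> /pairN_inj[/IHf-> /IHg->].
- by move=> /pairN_inj[/IHf-> /IHg->].
- by move=> /pairN_inj[/IHf-> /IHg->].
- by move=> /IHf->.
Qed.

Lemma ev_det A p x y z : ev A p x y -> ev A p x z -> y = z.
Proof.
elim: p x y z => /=; try by move=> x y z -> ->.
- move=> f IHf g IHg x y z [fy gy] [fz gz].
  by rewrite -[y]pairK -[z]pairK (IHf _ _ _ fy fz) (IHg _ _ _ gy gz).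
- move=> f IHf g IHg x y z [u gu fu] [v gv fv].
  by rewrite (IHg _ _ _ gu gv) in fu; exact: IHf fu fv.
- move=> f IHf g IHg x; elim: (sndN x) => [|n IHn] y z /=; first exact: IHf.
  by move=> [u /IHn ru gu] [v /ru <-]; exact: IHg gu.
- move=> f IHf x y z [fy ly] [fz lz].
  (* At the smaller of two distinct outputs, [f] would be 0 for one search and positive by
     minimality of the other. *)
  case: (ltngtP y z) => // [/lz|/ly] [v fv].
    by have := IHf _ _ _ fy fv.
  by have := IHf _ _ _ fz fv.
Qed.

(** Closure properties of total functions stand in for explicit programs; [turing_le A B] is, by
    conversion, the case of the characteristic function of [A]. *)
Definition computable (B : set nat) (f : nat -> nat) : Prop :=
  exists p, forall x, ev B p x (f x).

Section Computable.
Variable B : set nat.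
Local Notation computable := (computable B).

Lemma eq_computable f g : f =1 g -> computable f -> computable g.
Proof. by move=> fg [p pf]; exists p => x; rewrite -fg. Qed.

Lemma computable_comp f g :
  computable f -> computable g -> computable (fun x => f (g x)).
Proof. by move=> [p pf] [q qg]; exists (Comp p q) => x; exists (g x). Qed.

Lemma computable_pair f g :
  computable f -> computable g -> computable (fun x => pairN (f x) (g x)).
Proof.
by move=> [p pf] [q qg]; exists (Pair p q) => x /=; rewrite fstK sndK.
Qed.

Lemma computable_fst f : computable f -> computable (fun x => fstN (f x)).
Proof. by apply: computable_comp; exists Fst. Qed.

Lemma computable_snd f : computable f -> computable (fun x => sndN (f x)).
Proof. by apply: computable_comp; exists Snd. Qed.

Lemma computable_succ f : computable f -> computable (fun x => (f x).+1).
Proof. by apply: (@computable_comp succn); exists Succ. Qed.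

Lemma computable_oracle f : computable f -> computable (fun x => f x \in B).
Proof. by apply: (@computable_comp (fun x => x \in B)); exists Oracle. Qed.

(** Pairing the two projections gives the identity, for which [prog] has no constructor. *)
Lemma computable_id : computable id.
Proof. by exists (Pair Fst Snd) => x. Qed.

Lemma computable_const n : computable (fun=> n).
Proof. by elim: n => [|n /computable_succ//]; exists Zero. Qed.

(** The input is duplicated: one copy stays as the parameter of [Prec], the other determines the
    number of rounds. *)
Lemma computable_rec f (g : nat -> nat -> nat -> nat) n :
  computable f ->
  computable (fun w => g (fstN w) (fstN (sndN w)) (sndN (sndN w))) ->
  computable n -> computable (fun x => nat_rect (fun=> nat) (f x) (g x) (n x)).
Proof.
move=> [p pf] [q qg] /(computable_pair computable_id)[r rn].
exists (Comp (Prec p q) r) => x; exists (pairN x (n x)) => //=.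
rewrite fstK sndK; elim: (n x) => [|m IHm] //=; eexists; first exact: IHm.
by have := qg (pairN x (pairN m (nat_rect (fun=> nat) (f x) (g x) m)));
  rewrite !(fstK, sndK).
Qed.

Lemma computable_iter g a n : computable g -> computable a -> computable n ->
  computable (fun x => iter (n x) g (a x)).
Proof.
move=> cg ca cn; have cw : computable (fun w => g (sndN (sndN w))).
  by apply: computable_comp => //; do 2!apply: computable_snd; exact: computable_id.
apply: eq_computable (computable_rec (g := fun _ _ z => g z) ca cw cn) => x.
by elim: (n x) => //= m ->.
Qed.

Lemma computable_pred f : computable f -> computable (fun x => (f x).-1).
Proof.
move=> cf; have cw : computable (fun w => fstN (sndN w)).
  by apply: computable_fst; apply: computable_snd; exact: computable_id.
apply: eq_computable (computable_rec (g := fun _ m _ => m) (computable_const 0) cw cf) => x.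
by case: (f x).
Qed.

Lemma computable_sub f g :
  computable f -> computable g -> computable (fun x => f x - g x).
Proof.
move=> cf cg; have := computable_iter (computable_pred computable_id) cf cg.
by apply: eq_computable => x; elim: (g x) => [|m /= ->]; rewrite ?subn0 ?subnS.
Qed.

(** Case distinction as a recursion of length [a x - b x]: zero rounds leave [f x], and any round
    overwrites the value by [g x]. *)
Lemma computable_leq a b f g :
  computable a -> computable b -> computable f -> computable g ->
  computable (fun x => if a x <= b x then f x else g x).
Proof.
move=> ca cb cf cg.
have cw : computable (fun w => g (fstN w)).
  by apply: computable_comp => //; apply: computable_fst; exact: computable_id.
apply: eq_computable (computable_rec (g := fun x _ _ => g x) cf cw (computable_sub ca cb)) => x.
by rewrite leqNgt -subn_gt0; case: (a x - b x).
Qed.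

Lemma computable_odd f : computable f -> computable (fun x => odd (f x)).
Proof.
move=> cf; have := computable_iter
  (computable_sub (computable_const 1) computable_id) (computable_const 0) cf.
by apply: eq_computable => x; elim: (f x) => //= m ->; case: odd.
Qed.

Lemma computable_half f : computable f -> computable (fun x => (f x)./2).
Proof.
move=> cf; have cm : computable (fun w => fstN (sndN w)).
  by apply: computable_fst; apply: computable_snd; exact: computable_id.
have cz : computable (fun w => sndN (sndN w)).
  by do 2!apply: computable_snd; exact: computable_id.
have cw := computable_leq (computable_odd cm) (computable_const 0) cz (computable_succ cz).
have := computable_rec
  (g := fun _ m z => if odd m <= 0 then z else z.+1) (computable_const 0) cw cf.
apply: eq_computable => x; elim: (f x) => //= m ->.
by rewrite uphalf_half; case: odd.
Qed.

(* Entry [i] of a table [pairN t_(n-1) (... (pairN t_0 0))] sits at depth n-1-i. *)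
Definition tabulate (F : nat -> nat -> nat) (n : nat) : nat :=
  nat_rect (fun=> nat) 0 (fun m t => pairN (F m t) t) n.

Definition lookup (n t i : nat) : nat := fstN (iter (n.-1 - i) sndN t).

(** [F] receives the table of all earlier values, so a recursion may call itself at any smaller
    argument. *)
Definition course_of_values (F : nat -> nat -> nat) (n : nat) : nat :=
  F n (tabulate F n).

Lemma lookup_tabulate F n i :
  i < n -> lookup n (tabulate F n) i = course_of_values F i.
Proof.
rewrite /lookup; elim: n => //= n IHn; rewrite ltnS leq_eqVlt.
move=> /predU1P[->|lt_in]; first by rewrite subnn fstK.
rewrite -IHn// -[in n - i](ltn_predK lt_in) subSn; last by lia.
by rewrite iterSr sndK.
Qed.

Lemma computable_lookup n t i : computable n -> computable t -> computable i ->
  computable (fun x => lookup (n x) (t x) (i x)).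
Proof.
move=> cn ct ci; apply: computable_fst; apply: computable_iter => //.
  exact: computable_snd computable_id.
by apply: computable_sub => //; exact: computable_pred.
Qed.

Lemma computable_course_of_values F :
  computable (fun w => F (fstN w) (sndN w)) -> computable (course_of_values F).
Proof.
move=> cF; have cw : computable (fun w => pairN
    (F (fstN (sndN w)) (sndN (sndN w))) (sndN (sndN w))).
  apply: computable_pair; last by do 2!apply: computable_snd; exact: computable_id.
  by apply: (computable_comp cF); apply: computable_snd; exact: computable_id.
have ct := computable_rec (g := fun _ m t => pairN (F m t) t)
  (computable_const 0) cw computable_id.
apply: eq_computable (computable_comp cF (computable_pair computable_id ct)) => x.
by rewrite fstK sndK.
Qed.

(** The search condition ignores the candidate, so the search stops at 0 or never. Zero sets of
    computable functions thus become halting sets. *)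
Lemma computable_domain f : computable f ->
  exists p, forall x, (exists y, ev B p x y) <-> f x = 0.
Proof.
move=> [p pf]; exists (Mu (Comp p Fst)) => x /=; split=> [[y [[z -> fx0] _]]|fx0].
  by rewrite fstK in fx0; exact: ev_det (pf x) fx0.
by exists 0; split=> //; exists x; rewrite ?fstK// -fx0.
Qed.

End Computable.

Ltac computable := repeat first
  [ assumption | exact: computable_id | exact: computable_const
  | apply: computable_lookup | apply: computable_fst | apply: computable_snd | apply: computable_pair
  | apply: computable_succ | apply: computable_pred | apply: computable_sub
  | apply: computable_leq ].

Lemma turing_leE A B : turing_le A B <-> computable B (fun x => x \in A).
Proof. by []. Qed.

Lemma turing_le_set0 A : turing_le set0 A.
Proof.
apply/turing_leE; apply: eq_computable (computable_const A 0) => x.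
by rewrite in_set0.
Qed.

Lemma turing_le_reduction A B f : computable B f ->
  (forall x, A x <-> B (f x)) -> turing_le A B.
Proof.
move=> cf AB; apply/turing_leE; apply: eq_computable (computable_oracle cf) => x.
by congr nat_of_bool; apply/idP/idP; rewrite !in_setE => /AB.
Qed.

Lemma mem_oplus A B x :
  (x \in oplus A B) = if odd x then x./2 \in B else x./2 \in A.
Proof.
have {1}-> : x = odd x + x./2.*2 by rewrite odd_double_half.
case: odd; rewrite ?add1n ?add0n; apply/idP/idP; rewrite !in_setE /oplus /=.
- move=> [[y _ e]|[y By e]]; first by have := congr1 odd e; rewrite /= !odd_double.
  by move: By; have -> : y = x./2 by lia.
- by move=> Bx; right; exists x./2.
- move=> [[y Ay e]|[y _ e]]; last by have := congr1 odd e; rewrite /= !odd_double.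
  by move: Ay; have -> : y = x./2 by lia.
- by move=> Ax; left; exists x./2.
Qed.

Lemma oplus_le A B C : turing_le A C -> turing_le B C -> turing_le (oplus A B) C.
Proof.
rewrite !turing_leE => cA cB.
have half f : computable C f -> computable C (fun x => f x./2).
  by move=> cf; apply: (computable_comp cf); exact: computable_half (computable_id C).
have := computable_leq (computable_odd (computable_id C)) (computable_const C 0)
  (half _ cA) (half _ cB).
by apply: eq_computable => x; rewrite mem_oplus; case: odd.
Qed.

(** * The jump *)

(** A numeral as a program that ignores its input. Composing with it on the right fixes an input
    inside a code, as in the s-m-n theorem. *)
Fixpoint const_prog (n : nat) : prog :=
  if n is m.+1 then Comp Succ (const_prog m) else Zero.

Lemma ev_const A n x y : ev A (const_prog n) x y <-> y = n.
Proof.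
elim: n y => //= n IHn y; split=> [[z /IHn-> ->]//|->].
by exists n => //; apply/IHn.
Qed.

Lemma computable_encode_const B f :
  computable B f -> computable B (fun x => encode (const_prog (f x))).
Proof.
(* The tag of [Comp] is 6, so this function leads from the code of one numeral program to the code
   of the next. *)
move=> cf; have cw : computable B (fun c => pairN 6 (pairN (encode Succ) c)).
  by computable.
have := computable_iter cw (computable_const B (encode Zero)) cf.
by apply: eq_computable => x; elim: (f x) => //= m ->.
Qed.

Lemma jump_encode A p : jump A (encode p) <-> exists y, ev A p (encode p) y.
Proof. by split=> [[q /encode_inj->]|hy] //; exists p. Qed.

(** The jump feeds a program its own code; the constant discards it, so the jump answers halting
    questions at arbitrary inputs. *)
Lemma jump_encode_const A p n :
  jump A (encode (Comp p (const_prog n))) <-> exists y, ev A p n y.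
Proof.
rewrite jump_encode /=; split=> [[y [z /ev_const-> py]]|[y py]]; exists y => //.
by exists n => //; apply/ev_const.
Qed.

Lemma le_jump A : turing_le A (jump A).
Proof.
(* The difference vanishes exactly on [A], so [p] halts exactly on the members of [A]. *)
have [|p pA] := @computable_domain A (fun x => 1 - (x \in A)).
  by computable; exact: computable_oracle (computable_id A).
apply: (@turing_le_reduction _ _ (fun x => encode (Comp p (const_prog x)))).
  by computable; exact: computable_encode_const (computable_id _).
move=> x; rewrite jump_encode_const pA -(in_setE A x).
by case: (x \in A); split.
Qed.

(** Diagonal argument: were the jump decidable from [A], some [p] would halt exactly outside it; run
    [p] on its own code. *)
Lemma jump_not_le A : ~ turing_le (jump A) A.
Proof.
move=> /turing_leE/computable_domain[p pA].
have := pA (encode p); rewrite -jump_encode -(in_setE (jump A)).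
by case: (encode p \in jump A) => -[jp pj]; [move: (jp isT)|move: (pj erefl)].
Qed.

(** * Substituting a program for the oracle, on programs and on codes *)

Lemma ev_subst_inv (A B : set nat) q p : (forall x, ev A q x (x \in B)) ->
  forall x y, ev A (subst_oracle q p) x y -> ev B p x y.
Proof.
move=> qB; elim: p => //=.
(* Only the oracle case uses determinism: [q] has no output other than the oracle's answer. *)
- by move=> x y qx; exact: ev_det qx (qB x).
- by move=> f IHf g IHg x y [/IHf ? /IHg].
- by move=> f IHf g IHg x y [z /IHg ? /IHf]; exists z.
- move=> f IHf g IHg x y; elim: (sndN x) y => [|n IHn] y /=; first exact: IHf.
  by move=> [z /IHn ? /IHg]; exists z.
- move=> f IHf x y [/IHf ? f_gt0]; split=> // m /f_gt0[v /IHf]; by exists v.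
Qed.

Section SubstCode.
Variable q : prog.

(** The tests follow the tags of [encode]: 0 to 3 for the basic programs, copied unchanged, 4 for
    the oracle, 5 to 7 for the binary constructors, 8 for [Mu]. *)
Definition subst_step (e t : nat) : nat :=
  let look i := lookup e t i in
  let a := fstN e in let y := sndN e in
  if a <= 3 then (if y <= 0 then e.+1 else 0)
  else if a <= 4 then (if y <= 0 then (encode q).+1 else 0)
  else if a <= 7 then
    (if look (fstN y) <= 0 then 0 else
     if look (sndN y) <= 0 then 0 else
     (pairN a (pairN (look (fstN y)).-1 (look (sndN y)).-1)).+1)
  else if a <= 8 then
    (if look y <= 0 then 0 else (pairN a (look y).-1).+1)
  else 0.

(* Zero on numbers that code no program, a code plus one on the others. *)
Definition subst_code : nat -> nat := course_of_values subst_step.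

Lemma computable_subst_code B : computable B subst_code.
Proof. by apply: computable_course_of_values; rewrite /subst_step; computable. Qed.

Lemma subst_codeE a y : subst_code (pairN a y) =
  if a <= 3 then (if y <= 0 then (pairN a y).+1 else 0)
  else if a <= 4 then (if y <= 0 then (encode q).+1 else 0)
  else if a <= 7 then
    (if subst_code (fstN y) <= 0 then 0 else
     if subst_code (sndN y) <= 0 then 0 else
     (pairN a (pairN (subst_code (fstN y)).-1 (subst_code (sndN y)).-1)).+1)
  else if a <= 8 then
    (if subst_code y <= 0 then 0 else (pairN a (subst_code y).-1).+1)
  else 0.
Proof.
rewrite {1}/subst_code /course_of_values /subst_step fstK sndK.
(* Past tag 3 the payload is smaller than the code, so every lookup falls inside the table. *)
have [//|a_gt3] := leqP a 3; have lt_y : y < pairN a y by apply: pairN_gt; lia.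
rewrite !lookup_tabulate //; apply: leq_ltn_trans lt_y.
  exact: sndN_le.
exact: fstN_le.
Qed.

Lemma subst_code_encode p :
  subst_code (encode p) = (encode (subst_oracle q p)).+1.
Proof.
elim: p => [|||||f IHf g IHg|f IHf g IHg|f IHf g IHg|f IHf];
  by rewrite /= subst_codeE ?(fstK, sndK) //= ?IHf ?IHg.
Qed.

(** Together with [subst_code_encode], this makes the set of program codes decidable; a number
    outside it lies in no jump and needs separate treatment in [jump_le]. *)
Lemma subst_code_valid e : 0 < subst_code e -> exists p, encode p = e.
Proof.
elim/ltn_ind: e => e IHe; rewrite -[e]pairK.
set a := fstN e; set y := sndN e; rewrite subst_codeE.
have le_y : 0 < a -> y < e by move=> /(@pairN_gt _ y); rewrite pairK.
have lt1 : 0 < a -> fstN y < e by move=> /le_y; exact: leq_ltn_trans (fstN_le y).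
have lt2 : 0 < a -> sndN y < e by move=> /le_y; exact: leq_ltn_trans (sndN_le y).
have [a3|a3] := leqP a 3.
  case: (posnP y) => [->|]; last by case: (y).
  by move=> _; case: (a) a3 => [|[|[|[|]]]] // _;
    [exists Zero|exists Succ|exists Fst|exists Snd].
have a_gt0 : 0 < a by lia.
have [a4|a4] := leqP a 4.
  case: (posnP y) => [->|]; last by case: (y).
  by move=> _; exists Oracle => /=; congr pairN; lia.
have [a7|a7] := leqP a 7.
  have [//|/(IHe _ (lt1 a_gt0))[f fE]] := leqP (subst_code (fstN y)) 0.
  have [//|/(IHe _ (lt2 a_gt0))[g gE] _] := leqP (subst_code (sndN y)) 0.
  have -> : y = pairN (encode f) (encode g) by rewrite fE gE pairK.
  have [->|[->|->]] : a = 5 \/ a = 6 \/ a = 7 by lia.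
  - by exists (Pair f g).
  - by exists (Comp f g).
  - by exists (Prec f g).
have [a8|//] := leqP a 8.
have [//|/(IHe _ (le_y a_gt0))[f <-] _] := leqP (subst_code y) 0.
by exists (Mu f) => /=; congr pairN; lia.
Qed.

End SubstCode.

Lemma jump_le A B : turing_le A B -> turing_le (jump A) (jump B).
Proof.
(* The constant 1 has no zero, so [p0] halts nowhere; its code serves as the image of numbers that
   code no program. *)
move=> [q qA]; have [p0 p0P] := computable_domain (computable_const B 1).
(* Substitution changes the code of a program, so the constant [e] keeps the new program running on
   the original code. *)
pose f e := if subst_code q e <= 0 then encode p0 else
  pairN 6 (pairN (subst_code q e).-1 (encode (const_prog e))).
have cs := computable_subst_code q (jump B).
apply: (@turing_le_reduction _ _ f); rewrite /f.
  by computable; exact: computable_encode_const (computable_id _).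
move=> e; case: leqP => [|/subst_code_valid[p <-]].
  rewrite leqn0 => /eqP e0; split=> [[p pe _]|/jump_encode/p0P//].
  by rewrite -pe subst_code_encode in e0.
rewrite subst_code_encode -[pairN _ _]/(encode (Comp _ (const_prog _))).
rewrite jump_encode jump_encode_const; split=> -[y py]; exists y.
  exact: ev_subst py.
exact: ev_subst_inv py.
Qed.

Lemma iter_jump_le_limit k n : turing_le (iter n jump (limit_jump k)) (limit_jump k.+1).
Proof.
apply: (@turing_le_reduction _ _ (pairN n)); first by computable.
move=> x; split=> [nx|[m [y [/pairN_inj[-> ->]]]]] //.
by exists n, x.
Qed.

(** * Degrees and ideals *)

Lemma deg_repr (a : degree) : deg (repr a) = a.
Proof. exact: reprK. Qed.

Lemma deg0_le (a : degree) : (deg0 <= a)%O.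
Proof. by rewrite -[a]deg_repr; apply/deg_leP/turing_le_set0. Qed.

Lemma djoin_le (a b c : degree) : (a <= c)%O -> (b <= c)%O -> (djoin a b <= c)%O.
Proof.
move=> ac bc; rewrite -[c]deg_repr; apply/deg_leP/oplus_le;
  by apply/deg_leP; rewrite !deg_repr.
Qed.

(** Monotonicity of the jump on sets makes the choice of representative harmless. *)
Lemma djump_deg A : djump (deg A) = deg (jump A).
Proof. by have [? ?] := repr_degP A; apply/deg_eqP; split; exact: jump_le. Qed.

Lemma djump_le (a b : degree) : (a <= b)%O -> (djump a <= djump b)%O.
Proof.
by rewrite -[a]deg_repr -[b]deg_repr !djump_deg => /deg_leP ?; apply/deg_leP/jump_le.
Qed.

Lemma le_djump (a : degree) : (a <= djump a)%O.
Proof. by rewrite -{1}[a]deg_repr; apply/deg_leP/le_jump. Qed.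

Lemma djump_not_le (a : degree) : ~ (djump a <= a)%O.
Proof. by rewrite -{2}[a]deg_repr => /deg_leP/jump_not_le. Qed.

Lemma ideal_deg0 I : turing_ideal I -> I deg0.
Proof. by move=> [[a Ia] dI _]; apply: dI Ia (deg0_le a). Qed.

Lemma down_deg_ideal a : turing_ideal (down_deg a).
Proof.
split; first by exists a; exact: lexx.
- by move=> b c ca bc; exact: le_trans bc ca.
- by move=> b c; exact: djoin_le.
Qed.

(** An intersection of ideals is an ideal; it is nonempty because every ideal contains [deg0]. *)
Lemma ideal_gen_ideal S : turing_ideal (ideal_gen S).
Proof.
split; first by exists deg0 => M [/ideal_deg0].
- by move=> a b Ib ab M MS; have [_ dM _] := MS.1; exact: dM (Ib M MS) ab.
- by move=> a b Ia Ib M MS; have [_ _ jM] := MS.1; exact: jM (Ia M MS) (Ib M MS).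
Qed.

Lemma Theta_ideal I : turing_ideal (Theta I).
Proof. exact: ideal_gen_ideal. Qed.

Lemma sub_Gamma I : I `<=` Gamma I.
Proof. by move=> a Ia; exists (djump a); [exists a|exact: le_djump]. Qed.

Lemma Gamma_sub_Theta I : Gamma I `<=` Theta I.
Proof. by move=> a Ga; apply: sub_gen_smallest; left. Qed.

Lemma Theta_djump I a : I a -> Theta I (djump a).
Proof. by move=> Ia; apply: Gamma_sub_Theta; exists (djump a); [exists a|exact: lexx]. Qed.

Lemma Theta_sub I J : turing_ideal J -> Gamma I `<=` J ->
  (forall k, A_omega k `<=` Gamma I -> J (deg (zero_jump (k, 0)))) -> Theta I `<=` J.
Proof.
move=> idJ GJ AJ; apply: smallest_sub => // a [/GJ//|[k [_ Ak] <-]].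
exact: AJ.
Qed.

(** Index 0 is not among the generators, but there the degree is [deg0], which every ideal contains;
    inductions on [k] can thus treat 0 uniformly. *)
Lemma Theta_limit I k : A_omega k `<=` I -> Theta I (deg (zero_jump (k, 0))).
Proof.
case: k => [_|k AI]; first exact: ideal_deg0 (Theta_ideal _).
apply: sub_gen_smallest; right; exists k.+1 => //; split=> // a /AI.
exact: sub_Gamma.
Qed.

(** * The hierarchy of iterated jumps and the action of [Theta] on it *)

Lemma ltlxP (k n j m : nat) :
  (((k, n) : nat *l nat) < ((j, m) : nat *l nat))%O <-> k < j \/ k = j /\ n < m.
Proof. by rewrite ltxi_pair !leEnat ltEnat; lia. Qed.

Lemma zero_jump_succ k n : djump (deg (zero_jump (k, n))) = deg (zero_jump (k, n.+1)).
Proof. exact: djump_deg. Qed.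

(** Within a level each step is a jump; across levels, [limit_jump] bounds every column of the
    preceding level. *)
Lemma zero_jump_le (b c : nat *l nat) : (b <= c)%O ->
  (deg (zero_jump b) <= deg (zero_jump c))%O.
Proof.
case: b c => [k n] [j m].
have le_n i p r : p <= r -> (deg (zero_jump (i, p)) <= deg (zero_jump (i, r)))%O.
  move=> /subnK <-; elim: (r - p) => [|s IHs]; first exact: lexx.
  by apply: le_trans IHs _; rewrite addSn -zero_jump_succ; exact: le_djump.
have lt_k i r p : i < r -> (deg (zero_jump (i, p)) <= deg (zero_jump (r, 0)))%O.
  elim: r p => // r IHr p; rewrite ltnS leq_eqVlt => /predU1P[->|/IHr ir].
    exact/deg_leP/iter_jump_le_limit.
  by apply: le_trans (ir p) _; apply/deg_leP/(iter_jump_le_limit r 0).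
rewrite le_eqVlt => /predU1P[->|/ltlxP[kj|[-> /ltnW/le_n//]]]; first exact: lexx.
exact: le_trans (lt_k _ _ _ kj) (le_n _ _ _ (leq0n m)).
Qed.

(** The successor of [b] is at most [c], so a reduction from [c] to [b] would put a jump below its
    own argument. *)
Lemma zero_jump_lt (b c : nat *l nat) : (b < c)%O ->
  ~ (deg (zero_jump c) <= deg (zero_jump b))%O.
Proof.
case: b c => [k n] [j m] bc cb; apply: (@djump_not_le (deg (zero_jump (k, n)))).
rewrite zero_jump_succ; apply: le_trans cb; apply: zero_jump_le.
by rewrite leNgt; apply/negP; move/ltlxP: bc => bc /ltlxP; lia.
Qed.

Lemma A_omegaP k a :
  A_omega k a <-> exists j n, j < k /\ (a <= deg (zero_jump (j, n)))%O.
Proof.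
split=> [[[j n] /= /ltlxP jk an]|[j [n [jk an]]]].
  by exists j, n; split=> //; lia.
by exists (j, n) => //=; apply/ltlxP; left.
Qed.

Lemma A_omega_sub k n j : A_omega j `<=` down_deg (deg (zero_jump (k, n))) -> j <= k.
Proof.
move=> Aj; rewrite leqNgt; apply/negP => kj.
have /Aj : A_omega j (deg (zero_jump (k, n.+1))).
  by apply/A_omegaP; exists k, n.+1; split=> //; exact: lexx.
by apply: zero_jump_lt; apply/ltlxP; right.
Qed.

Lemma Theta_down k n :
  Theta (down_deg (deg (zero_jump (k, n)))) `<=` down_deg (deg (zero_jump (k, n.+1))).
Proof.
have GS : Gamma (down_deg (deg (zero_jump (k, n))))
    `<=` down_deg (deg (zero_jump (k, n.+1))).
  move=> a [_ [b bk <-] ab]; apply: le_trans ab _.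
  by rewrite -zero_jump_succ; exact: djump_le.
apply: Theta_sub => // [|j Aj]; first exact: down_deg_ideal.
apply: zero_jump_le; rewrite leNgt; apply/negP => /ltlxP.
(* Applied with [n.+1], the bound on [Gamma] gives [j <= k], while the negated goal places [(j, 0)]
   above [(k, n.+1)]. *)
by have := A_omega_sub (subset_trans Aj GS); lia.
Qed.

Lemma Theta_mono I J : I `<=` J -> Theta I `<=` Theta J.
Proof.
move=> IJ; have GG : Gamma I `<=` Gamma J.
  by move=> a [_ [b /IJ Jb <-] ab]; exists (djump b) => //; exists b.
apply: Theta_sub; first exact: Theta_ideal.
  exact: subset_trans GG (@Gamma_sub_Theta J).
case=> [_|k Ak]; first exact: ideal_deg0 (Theta_ideal _).
apply: sub_gen_smallest; right; exists k.+1 => //; split=> //.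
exact: subset_trans Ak GG.
Qed.

Lemma A_omega2_ideal : turing_ideal A_omega2.
Proof.
split; first by exists deg0, (0, 0) => //; exact: lexx.
- by move=> a b [c _ bc] ab; exists c => //; exact: le_trans ab bc.
(* The indices are totally ordered, so the larger one bounds both degrees and hence their join. *)
- move=> a b [c _ ac] [d _ bd]; exists (Order.max c d) => //.
  apply: djoin_le; [apply: le_trans ac _|apply: le_trans bd _];
    by apply: zero_jump_le; rewrite le_max lexx ?orbT.
Qed.

Lemma Theta_A_omega2 : Theta A_omega2 = A_omega2.
Proof.
apply/seteqP; split.
  apply: Theta_sub => [|a [_ [b [[k n] _ bk] <-] ab]|k _].
  - exact: A_omega2_ideal.
  - exists (k, n.+1) => //; apply: le_trans ab _.
    by rewrite -zero_jump_succ; exact: djump_le.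
  - by exists (k, 0) => //; exact: lexx.
exact: subset_trans (@sub_Gamma _) (@Gamma_sub_Theta _).
Qed.

Lemma A_omega2_sub_fixpoint J : turing_ideal J -> Theta J = J -> A_omega2 `<=` J.
Proof.
move=> idJ fixJ; have [_ dJ _] := idJ.
suff zJ k n : J (deg (zero_jump (k, n))) by move=> a [[k n] _]; exact: dJ.
elim/ltn_ind: k n => k IHk; elim=> [|n IHn].
  rewrite -fixJ; apply: Theta_limit => a /A_omegaP[j [n [jk]]].
  exact: dJ (IHk _ jk _).
by rewrite -zero_jump_succ -fixJ; exact: Theta_djump.
Qed.

(** * The iteration *)

Local Notation It := (iteration ord3_wf Theta (down_deg deg0)).

Lemma ord3_ltP (i k n j l m : nat) :
  (((i, (k, n)) : ord3) < ((j, (l, m)) : ord3))%O <->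
  i < j \/ i = j /\ (k < l \/ k = l /\ n < m).
Proof. by rewrite ltxi_pair !leEnat ltxi_pair !leEnat !ltEnat; lia. Qed.

Lemma ord3_leP (i k n j l m : nat) :
  (((i, (k, n)) : ord3) <= ((j, (l, m)) : ord3))%O <->
  i < j \/ i = j /\ (k < l \/ k = l /\ n <= m).
Proof. by rewrite leNgt; split=> [/negP|le_ab]; [|apply/negP]; rewrite ord3_ltP; lia. Qed.

Lemma iteration0 : It (0, (0, 0)) = down_deg deg0.
Proof. by apply: iteration_zero => -[i [k n]]; apply/ord3_leP; lia. Qed.

Lemma iterationS i k n : It (i, (k, n.+1)) = Theta (It (i, (k, n))).
Proof.
apply: iteration_succ; split; first by apply/ord3_ltP; lia.
by move=> [j [l m]] /ord3_ltP ?; apply/ord3_leP; lia.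
Qed.

Lemma limit_ord3 (a : ord3) : a.2.2 = 0 -> a <> (0, (0, 0)) -> is_limit_ord a.
Proof.
case: a => i [k n] /= -> a0; split.
  move=> /(_ (0, (0, 0)))/ord3_leP le0; apply: a0.
  by have [-> ->] : i = 0 /\ k = 0 by lia.
(* An immediate predecessor [(j, (l, m))] would force the ordinal to be [(j, (l, m.+1))], whose last
   coordinate is not 0. *)
move=> [[j [l m]] [/ord3_ltP lt_ba /(_ (j, (l, m.+1)))]].
have /[swap]/[apply] : (((j, (l, m)) : ord3) < ((j, (l, m.+1)) : ord3))%O by apply/ord3_ltP; lia.
by move=> /ord3_leP; lia.
Qed.

Lemma iteration_lim (a : ord3) : a.2.2 = 0 -> a <> (0, (0, 0)) ->
  It a = \bigcup_(b in [set b | (b < a)%O]) It b.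
Proof. by move=> a2 a0; apply: iteration_limit; exact: limit_ord3. Qed.

(** A limit stage is only a union, bounded through earlier levels; at a successor stage,
    monotonicity reduces the claim to [Theta_down]. *)
Lemma iteration_ub k n : It (0, (k, n)) `<=` down_deg (deg (zero_jump (k, n))).
Proof.
elim/ltn_ind: k n => k IHk; elim=> [|n IHn].
  case: k IHk => [|k] IHk; first by rewrite iteration0.
  rewrite iteration_lim// => a [[j [l m]] /= /ord3_ltP lt_b].
  have -> : j = 0 by lia.
  have lk : l < k.+1 by lia.
  move=> /(IHk _ lk) ab; apply: le_trans ab _; apply: zero_jump_le.
  by apply/ltW/ltlxP; left.
rewrite iterationS; exact: subset_trans (Theta_mono IHn) (@Theta_down k n).
Qed.

(** The shift by one arises at limits: for [k] positive, the stage at [(k, 0)] contains [A_omega k]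
    but only the next application of [Theta] adjoins the limit jump. *)
Lemma iteration_lb k n : It (0, (k, n.+1)) (deg (zero_jump (k, n))).
Proof.
elim/ltn_ind: k n => k IHk; elim=> [|n IHn]; rewrite iterationS; last first.
  by rewrite -zero_jump_succ; exact: Theta_djump.
apply: Theta_limit => a /A_omegaP[j [m [jk am]]].
(* The stage is a limit because [j < k] excludes [k = 0]. *)
rewrite iteration_lim => [||[]]//; last by move: jk => /[swap] ->.
exists (0, (j, m.+1)); first by apply/ord3_ltP; lia.
(* Written as a value of [Theta], this stage is an ideal, which gives downward closure without a
   separate induction on stages. *)
move: (IHk _ jk m); rewrite iterationS => Im.
by have [_ dI _] := Theta_ideal (It (0, (j, m))); exact: dI Im am.
Qed.

Lemma iteration_omega2 : It omega2 = A_omega2.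
Proof.
rewrite iteration_lim//; apply/seteqP; split=> a.
  move=> [[i [k n]] /ord3_ltP lt_b]; have -> : i = 0 by lia.
  by move=> /iteration_ub ?; exists (k, n).
move=> [[k n] _ an]; exists (0, (k, n.+1)); first by apply/ord3_ltP; lia.
move: (@iteration_lb k n); rewrite iterationS => In.
by have [_ dI _] := Theta_ideal (It (0, (k, n))); exact: dI In an.
Qed.

Theorem theorem6p2 :
  [/\ (forall I : set degree, turing_ideal I -> turing_ideal (Theta I)),
      is_closure_ordinal ord3_wf Theta (down_deg deg0) omega2 &
      is_least_fixpoint Theta A_omega2].
Proof.
split; first by move=> I _; exact: Theta_ideal.
- split=> [|[i [k n]] fixI]; first by rewrite iteration_omega2 Theta_A_omega2.
  rewrite leNgt; apply/negP => /ord3_ltP lt_i; have i0 : i = 0 by lia.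
  rewrite i0 in fixI.
  have idI : turing_ideal (It (0, (k, n))) by rewrite -fixI; exact: Theta_ideal.
  (* A fixed stage contains all of [A_omega2], in particular the degree of index [(k, n.+1)], which
     exceeds the bound of index [(k, n)] on this stage. *)
  have /(A_omega2_sub_fixpoint idI fixI)/iteration_ub :
      A_omega2 (deg (zero_jump (k, n.+1))) by exists (k, n.+1) => //; exact: lexx.
  by apply: zero_jump_lt; apply/ltlxP; right.
- split; [exact: A_omega2_ideal|exact: Theta_A_omega2|exact: A_omega2_sub_fixpoint].
Qed.
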